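(* Let $\phi:\mathbb{R}^n\to\mathbb{R}$ be continuously differentiable with $\|\nabla\phi(u_1)-\nabla\phi(u_2)\|\le L_\phi\|u_1-u_2\|$ for all $u_1,u_2$, let $g:\mathbb{R}^{n+m}\times\mathbb{R}^n\to\mathbb{R}^{n+m}$ and $h:\mathbb{R}^{n+m}\to\mathbb{R}^n$ be continuous, and let $v$ be a UPE function. Suppose the discrete-time system with input $e$, $$\tilde\eta^+=g(\tilde\eta,\nabla\phi(h(\tilde\eta))+e),$$ is ISS with respect to a compact set $\mathcal{A}_d\subset\mathbb{R}^{n+m}$, with gain $\alpha\in\mathcal{K}_\infty$. Then for every $a>0$ there exists a compact set $\bar{\mathcal{A}}\subset\mathcal{A}_d+\alpha(M_v^3L_\phi a)\mathbb{B}$ such that $\bar{\mathcal{A}}\times[0,1]$ is UGAS for $\bar{\mathcal{H}}$.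
   Context: The discrete-time system $\tilde\eta^+=G_d(\tilde\eta,e)$ is input-to-state stable (ISS) with respect to a compact set $\mathcal{A}_d$ if there exist $\beta\in\mathcal{KL}$ and $\alpha\in\mathcal{K}_\infty$ such that for every bounded input sequence $e:\mathbb{N}\to\mathbb{R}^n$ every solution satisfies $|\tilde\eta(j)|_{\mathcal{A}_d}\le\beta(|\tilde\eta(0)|_{\mathcal{A}_d},j)+\alpha(\|e\|_\infty)$ for all $j$, where $\|e\|_\infty=\sup_k\|e(k)\|$ and $|x|_{\mathcal{A}}=\min_{y\in\mathcal{A}}\|x-y\|$. $\mathbb{B}$ is the closed unit ball. Hybrid systems: data $(C,F,D,G)$, $\dot\xi=F(\xi)$ on $C$, $\xi^+=G(\xi)$ on $D$, solutions on hybrid time domains (standard Goebel–Sanfelice–Teel framework). A compact set $\mathcal{A}$ is UGAS if there is $\beta\in\mathcal{KL}$ with $|\xi(t,j)|_{\mathcal{A}}\le\beta(|\xi(0,0)|_{\mathcal{A}},t+j)$ for every solution and all $(t,j)$ in its domain. UPE: $v:[0,1]\to\mathbb{R}^n$ continuous with $\int_0^1v=0$, $\int_0^1vv^\top=I$; $M_v=\sup_{\tau\in[0,1]}\|v(\tau)\|$. $\bar\Phi_a(u)=a^{-1}\int_0^1\phi(u+av(\tau))v(\tau)\,d\tau$. $\bar{\mathcal{H}}$: state $(\bar\eta,\bar\tau)\in\mathbb{R}^{n+m}\times\mathbb{R}$, $\bar C=\mathbb{R}^{n+m}\times[0,1]$, $\bar D=\mathbb{R}^{n+m}\times\{1\}$,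 $\bar F=(0,1)$, $\bar G=(g(\bar\eta,\bar\Phi_a(h(\bar\eta))),0)$. *)

(* Defs.v *)
From HB Require Import structures.
From mathcomp Require Import all_boot all_order all_algebra.
From mathcomp Require Import all_classical all_reals all_analysis.
Set Implicit Arguments. Unset Strict Implicit. Unset Printing Implicit Defensive.
Import Order.TTheory GRing.Theory Num.Theory.
Import numFieldNormedType.Exports.
Local Open Scope classical_set_scope.
Local Open Scope ring_scope.

Section Defs.
Variable R : realType.

Definition dotv (k : nat) (u w : 'cV[R]_k) : R := \sum_(i < k) u i 0 * w i 0.
Definition enorm (k : nat) (u : 'cV[R]_k) : R := Num.sqrt (dotv u u).

(** |x|_A = min_{y in A} ||x - y|| (for compact nonempty A the inf is a min). *)
Definition dist_set (k : nat) (A : set 'cV[R]_k) (x : 'cV[R]_k) : R :=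
  inf [set enorm (x - y) | y in A].

Definition dist_set_hyb (k : nat) (A : set ('cV[R]_k * R)) (x : 'cV[R]_k * R) : R :=
  inf [set Num.sqrt (enorm (x.1 - y.1) ^+ 2 + (x.2 - y.2) ^+ 2) | y in A].

Definition inflate (k : nat) (A : set 'cV[R]_k) (r : R) : set 'cV[R]_k :=
  [set x | exists2 y, A y & enorm (x - y) <= r].

Definition class_K (f : R -> R) : Prop :=
  f 0 = 0 /\ {within `[0, +oo[, continuous f} /\
  (forall r s, 0 <= r -> r < s -> f r < f s).
Definition class_Kinf (f : R -> R) : Prop :=
  class_K f /\ (forall M, exists2 s, 0 <= s & M < f s).
Definition class_KL (b : R -> R -> R) : Prop :=
  (forall s, 0 <= s -> class_K (fun r => b r s)) /\
  (forall r, 0 <= r ->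
     (forall s1 s2, 0 <= s1 -> s1 <= s2 -> b r s2 <= b r s1) /\
     (b r x @[x --> +oo] --> 0)).

Definition is_gradient (n : nat) (phi : 'cV[R]_n -> R) (grad : 'cV[R]_n -> 'cV[R]_n)
  : Prop :=
  forall u, differentiable phi u /\ forall w, 'd phi u w = dotv (grad u) w.

Definition unit_int : set R := `[0, 1].
Definition int01 (f : R -> R) : R := \int[lebesgue_measure]_(t in unit_int) f t.

Definition UPE (n : nat) (v : R -> 'cV[R]_n) : Prop :=
  {within unit_int, continuous v} /\
  (forall i, int01 (fun t => v t i 0) = 0) /\
  (forall i j, int01 (fun t => v t i 0 * v t j 0) = (i == j)%:R).

Definition M_v (n : nat) (v : R -> 'cV[R]_n) : R := sup [set enorm (v t) | t in unit_int].

Definition Phibar (n : nat) (phi : 'cV[R]_n -> R) (v : R -> 'cV[R]_n) (a : R)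
  (u : 'cV[R]_n) : 'cV[R]_n :=
  a^-1 *: \col_i int01 (fun t => phi (u + a *: v t) * v t i 0).

Definition bounded_input (n : nat) (e : nat -> 'cV[R]_n) : Prop :=
  exists M, forall k, enorm (e k) <= M.
Definition sup_input (n : nat) (e : nat -> 'cV[R]_n) : R :=
  sup [set enorm (e k) | k in [set: nat]].
Definition ISS_with_gain (N n : nat) (Gd : 'cV[R]_N -> 'cV[R]_n -> 'cV[R]_N)
  (A : set 'cV[R]_N) (alpha : R -> R) : Prop :=
  exists2 beta, class_KL beta &
  forall (e : nat -> 'cV[R]_n) (eta : nat -> 'cV[R]_N),
    bounded_input e ->
    (forall j, eta j.+1 = Gd (eta j) (e j)) ->
    forall j, dist_set A (eta j) <= beta (dist_set A (eta 0%N)) j%:R + alpha (sup_input e).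

Definition compact_htd (S : set (R * nat)) : Prop :=
  exists (K : nat) (t : nat -> R), t 0%N = 0 /\
    (forall j, (j < K)%N -> t j <= t j.+1) /\
    S = [set p | (p.2 < K)%N /\ t p.2 <= p.1 <= t p.2.+1].
Definition hybrid_time_domain (E : set (R * nat)) : Prop :=
  E `<=` [set p | 0 <= p.1] /\
  forall T J, E (T, J) -> compact_htd (E `&` [set p | 0 <= p.1 <= T /\ (p.2 <= J)%N]).

Definition hybrid_solution (X : normedModType R) (C : set X) (F : X -> X) (D : set X)
  (G : X -> X) (E : set (R * nat)) (xi : R -> nat -> X) : Prop :=
  hybrid_time_domain E /\ E (0, 0%N) /\ (closure C `|` D) (xi 0 0%N) /\
  (forall j, let I := [set t | E (t, j)] in interior I !=set0 ->
     {within I, continuous (fun s => xi s j)} /\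
     (forall t, interior I t ->
        C (xi t j) /\ is_derive t 1 (fun s => xi s j) (F (xi t j)))) /\
  (forall t j, E (t, j) -> E (t, j.+1) -> D (xi t j) /\ xi t j.+1 = G (xi t j)).

Definition UGAS_hyb (k : nat) (C : set ('cV[R]_k * R)) (F : 'cV[R]_k * R -> 'cV[R]_k * R)
  (D : set ('cV[R]_k * R)) (G : 'cV[R]_k * R -> 'cV[R]_k * R) (A : set ('cV[R]_k * R)) : Prop :=
  exists2 beta, class_KL beta &
  forall E xi, hybrid_solution C F D G E xi ->
    forall t j, E (t, j) ->
      dist_set_hyb A (xi t j) <= beta (dist_set_hyb A (xi 0 0%N)) (t + j%:R).

Definition Hbar_C (N : nat) : set ('cV[R]_N * R) := [set x | unit_int x.2].
Definition Hbar_F (N : nat) (x : 'cV[R]_N * R) : 'cV[R]_N * R := (0, 1).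
Definition Hbar_D (N : nat) : set ('cV[R]_N * R) := [set x | x.2 = 1].
Definition Hbar_G (N n : nat) (g : 'cV[R]_N -> 'cV[R]_n -> 'cV[R]_N)
  (h : 'cV[R]_N -> 'cV[R]_n) (phi : 'cV[R]_n -> R) (v : R -> 'cV[R]_n) (a : R)
  (x : 'cV[R]_N * R) : 'cV[R]_N * R :=
  (g x.1 (Phibar phi v a (h x.1)), 0).

End Defs.

(* Main.v *)
Require Import Defs.
From HB Require Import structures.
From mathcomp Require Import all_boot all_order all_algebra.
From mathcomp Require Import all_classical all_reals all_analysis.
From mathcomp Require Import zify ring lra.
Set Implicit Arguments.
Unset Strict Implicit.
Unset Printing Implicit Defensive.
Import Order.TTheory GRing.Theory Num.Theory.
Import numFieldNormedType.Exports.
Local Open Scope classical_set_scope.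
Local Open Scope ring_scope.

(* Since $\int v = 0$ and $\int v v^T = I$, replacing phi by its first-order
   Taylor remainder turns the averaged map Phibar into grad phi plus an error of
   size at most M_v^3 L a.  The averaged jump map is therefore the ISS system
   driven by a bounded input, so its trajectories enter every neighbourhood of
   the alpha-inflation of Ad, and the omega-limit set of such a neighbourhood is
   a compact attractor.  By compactness the latter is Lyapunov stable and
   uniformly attractive, which is converted into a KL estimate.  Flows of Hbar
   only advance the clock, each for a time at most 1, so hybrid time t + j is at
   most 2 j + 1 and the discrete estimate carries over. *)

(** * The Euclidean norm and the distance to a set *)

(** The ISS estimate makes the set of points within alpha(c) of Ad attractive, c being the bound on
    the error, but not invariant: a trajectory that starts there may leave it for a while, so this
    set need not be stable. Passing to the omega-limit set restores invariance, by continuity of the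
    jump map, and costs nothing in size: late iterates have lost their beta term, so their limits
    lie within alpha(c) exactly, whatever slack the starting neighbourhood had. The constant in c
    arises as follows: the Taylor remainder is at most L (a M_v)^2, the factor v contributes another
    M_v, and the average is divided by a. For the KL estimate, the obvious candidate, the supremum
    of the later distances over all trajectories starting within r, may jump as r varies, whereas
    [class_K] asks for continuity and strict growth. The supremum is therefore weighted by a
    Lipschitz cutoff, and a strictly increasing term is added. *)

Lemma dotvC (R : realType) k (u w : 'cV[R]_k) : dotv u w = dotv w u.
Proof. by apply: eq_bigr => i _; rewrite mulrC. Qed.

Lemma dotvDl (R : realType) k (u1 u2 w : 'cV[R]_k) :
  dotv (u1 + u2) w = dotv u1 w + dotv u2 w.
Proof.
by rewrite /dotv -big_split; apply: eq_bigr => i _; rewrite mxE mulrDl.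
Qed.

Lemma dotvZl (R : realType) k (c : R) (u w : 'cV[R]_k) :
  dotv (c *: u) w = c * dotv u w.
Proof. by rewrite /dotv mulr_sumr; apply: eq_bigr => i _; rewrite mxE mulrA. Qed.

Lemma dotvNl (R : realType) k (u w : 'cV[R]_k) : dotv (- u) w = - dotv u w.
Proof. by rewrite -scaleN1r dotvZl mulN1r. Qed.

Lemma dotvBl (R : realType) k (u1 u2 w : 'cV[R]_k) :
  dotv (u1 - u2) w = dotv u1 w - dotv u2 w.
Proof. by rewrite dotvDl dotvNl. Qed.

Lemma dotvDr (R : realType) k (u w1 w2 : 'cV[R]_k) :
  dotv u (w1 + w2) = dotv u w1 + dotv u w2.
Proof. by rewrite dotvC dotvDl !(dotvC u). Qed.

Lemma dotvZr (R : realType) k (c : R) (u w : 'cV[R]_k) :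
  dotv u (c *: w) = c * dotv u w.
Proof. by rewrite dotvC dotvZl dotvC. Qed.

Lemma dotv0l (R : realType) k (w : 'cV[R]_k) : dotv 0 w = 0.
Proof. by apply: big1 => i _; rewrite mxE mul0r. Qed.

Lemma dotvv_ge0 (R : realType) k (u : 'cV[R]_k) : 0 <= dotv u u.
Proof. by apply: sumr_ge0 => i _; rewrite -expr2 sqr_ge0. Qed.

Lemma enorm_ge0 (R : realType) k (u : 'cV[R]_k) : 0 <= enorm u.
Proof. exact: sqrtr_ge0. Qed.

Lemma sqr_enorm (R : realType) k (u : 'cV[R]_k) : enorm u ^+ 2 = dotv u u.
Proof. by rewrite sqr_sqrtr// dotvv_ge0. Qed.

Lemma coord_le_enorm (R : realType) k (u : 'cV[R]_k) i : `|u i 0| <= enorm u.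
Proof.
rewrite -ler_sqr ?nnegrE// ?enorm_ge0// sqr_enorm real_normK ?num_real//.
rewrite /dotv (bigD1 i)//= expr2 lerDl; apply: sumr_ge0 => j _.
by rewrite -expr2 sqr_ge0.
Qed.

Lemma enorm_eq0 (R : realType) k (u : 'cV[R]_k) : enorm u = 0 -> u = 0.
Proof.
move=> u0; apply/matrixP => i j; rewrite ord1 mxE; apply/eqP.
by rewrite -normr_le0 -u0 coord_le_enorm.
Qed.

Lemma enorm0 (R : realType) k : enorm (0 : 'cV[R]_k) = 0.
Proof. by rewrite /enorm dotv0l sqrtr0. Qed.

Lemma enormZ (R : realType) k (c : R) (u : 'cV[R]_k) :
  enorm (c *: u) = `|c| * enorm u.
Proof.
by rewrite /enorm dotvZl dotvZr mulrA -expr2 sqrtrM ?sqr_ge0// sqrtr_sqr.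
Qed.

Lemma enormN (R : realType) k (u : 'cV[R]_k) : enorm (- u) = enorm u.
Proof. by rewrite -scaleN1r enormZ normrN1 mul1r. Qed.

Lemma enormBC (R : realType) k (u w : 'cV[R]_k) : enorm (u - w) = enorm (w - u).
Proof. by rewrite -enormN opprB. Qed.

Lemma dotv_le_enorm (R : realType) k (u w : 'cV[R]_k) :
  dotv u w <= enorm u * enorm w.
Proof.
have [/enorm_eq0->|u0] := eqVneq (enorm u) 0.
  by rewrite enorm0 mul0r dotv0l.
have [/enorm_eq0->|w0] := eqVneq (enorm w) 0.
  by rewrite enorm0 mulr0 dotvC dotv0l.
have up : 0 < enorm u by rewrite lt_neqAle eq_sym u0 enorm_ge0.
have wp : 0 < enorm w by rewrite lt_neqAle eq_sym w0 enorm_ge0.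
(* The square expands to 2 |u| |w| (|u| |w| - u.w), and |u| |w| is positive here. *)
have := dotvv_ge0 (enorm w *: u + - enorm u *: w).
rewrite dotvDl !dotvZl !dotvDr !dotvZr (dotvC w u) -!sqr_enorm => H.
have := mulr_gt0 up wp; nra.
Qed.

Lemma normr_dotv (R : realType) k (u w : 'cV[R]_k) :
  `|dotv u w| <= enorm u * enorm w.
Proof.
by rewrite ler_norml dotv_le_enorm lerNl -dotvNl -(enormN u) dotv_le_enorm.
Qed.

Lemma enormD (R : realType) k (u w : 'cV[R]_k) :
  enorm (u + w) <= enorm u + enorm w.
Proof.
rewrite -ler_sqr ?nnegrE ?addr_ge0 ?enorm_ge0// sqrrD !sqr_enorm.
rewrite dotvDl !dotvDr (dotvC w u).
have := dotv_le_enorm u w; lra.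
Qed.

Lemma enormB_tri (R : realType) k (u w x : 'cV[R]_k) :
  enorm (u - w) <= enorm (u - x) + enorm (x - w).
Proof. by rewrite -[u - w](subrKA x) enormD. Qed.

Lemma normr_coord (R : realType) p q (x : 'M[R]_(p, q)) i j :
  `|x i j| <= `|x|.
Proof.
have -> : `|x| = \big[Num.max/0]_ij `|x ij.1 ij.2| by exact: mx_normrE.
exact: (le_bigmax _ (fun ij => `|x ij.1 ij.2|) (i, j)).
Qed.

Lemma normr_mx_le (R : realType) p q (x : 'M[R]_(p, q)) (M : R) :
  0 <= M -> (forall i j, `|x i j| <= M) -> `|x| <= M.
Proof.
move=> M0 xM.
have -> : `|x| = \big[Num.max/0]_ij `|x ij.1 ij.2| by exact: mx_normrE.
by apply/bigmax_leP; split => // -[i j] _; exact: xM.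
Qed.

(** With [normr_le_enorm], this compares the Euclidean norm with the max norm that carries the
    topology. The crude factor [k.+1] is positive even for k = 0, so one may divide by it. *)
Lemma enorm_le_normr (R : realType) k (u : 'cV[R]_k) :
  enorm u <= k.+1%:R * `|u|.
Proof.
rewrite -ler_sqr ?nnegrE ?mulr_ge0// ?enorm_ge0// sqr_enorm.
apply: (@le_trans _ _ (\sum_(i < k) `|u| ^+ 2)).
  apply: ler_sum => i _; rewrite -expr2 -[u i 0 ^+ 2]real_normK ?num_real//.
  by rewrite ler_sqr ?nnegrE// normr_coord.
rewrite sumr_const card_ord -[leLHS]mulr_natl exprMn ler_wpM2r ?sqr_ge0//.
by rewrite -natrX ler_nat; nia.
Qed.

Lemma normr_le_enorm (R : realType) k (u : 'cV[R]_k) : `|u| <= enorm u.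
Proof.
apply: normr_mx_le => [|i j]; first exact: enorm_ge0.
by rewrite ord1 coord_le_enorm.
Qed.

Lemma near_enorm (R : realType) k (x : 'cV[R]_k) (e : R) :
  0 < e -> \forall y \near x, enorm (x - y) < e.
Proof.
move=> e0; have ek : 0 < e / k.+1%:R by rewrite divr_gt0 ?ltr0n.
have := nbhsx_ballx x _ ek; rewrite -ball_normE; apply: filterS => y /= xy.
apply: le_lt_trans (enorm_le_normr _) _.
by rewrite mulrC -ltr_pdivlMr ?ltr0n.
Qed.

Lemma enorm_continuous (R : realType) k : continuous (@enorm R k).
Proof.
move=> x; apply/(@cvgrPdist_lt _ _ _ (nbhs x)) => e e0.
have := near_enorm x e0; apply: filterS => y; apply: le_lt_trans.
rewrite ler_norml.
have := enormD (x - y) y; have := enormD (y - x) x.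
by rewrite !subrK (enormBC y x) => ? ?; apply/andP; split; lra.
Qed.

(** Heine-Borel for row vectors, carried over by transposition, which does not increase the max norm
    and is therefore continuous. *)
Lemma cV_bounded_closed_compact (R : realType) k (A : set 'cV[R]_k) (M : R) :
  (forall x, A x -> enorm x <= M) -> closed A -> compact A.
Proof.
move=> AM clA.
have ctr p q : continuous (@trmx R p q).
  move=> x; apply/(@cvgrPdist_lt _ _ _ (nbhs x)) => e e0.
  have := nbhsx_ballx x _ e0; rewrite -ball_normE; apply: filterS => y /=.
  apply: le_lt_trans.
  rewrite -linearB/=.
  by apply: normr_mx_le => // i j; rewrite mxE normr_coord.
have -> : A = (@trmx R 1 k) @` (@trmx R 1 k @^-1` A).
  rewrite image_preimage// -subTset => x _ /=.
  by exists x^T; rewrite ?trmxK.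
apply: continuous_compact; first exact/continuous_subspaceT/ctr.
apply: bounded_closed_compact.
  exists M; split; first exact: num_real.
  move=> N MN x /= /AM xM; apply: le_trans (ltW MN); apply: le_trans xM.
  apply: le_trans (normr_le_enorm _).
  apply: normr_mx_le => // i j.
  by rewrite (_ : x i j = x^T j i) ?normr_coord// mxE.
by apply: closed_comp => // x _; exact: ctr.
Qed.

Lemma compact_enorm_bound (R : realType) k (A : set 'cV[R]_k) :
  compact A -> exists M, forall x, A x -> enorm x <= M.
Proof.
move=> cA; have [->|/set0P A0] := eqVneq A set0; first by exists 0.
have cE : {within A, continuous (@enorm R k)}.
  exact/continuous_subspaceT/enorm_continuous.
have [c _ H] := compact_EVT_max A0 cA cE.
by exists (enorm c) => x Ax; apply: H; rewrite inE.
Qed.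

Lemma dist_set_has_inf (R : realType) k (A : set 'cV[R]_k) (x : 'cV[R]_k) :
  A !=set0 -> has_inf [set enorm (x - y) | y in A].
Proof.
move=> [y Ay]; split; first by exists (enorm (x - y)), y.
by exists 0 => _ [z _ <-]; exact: enorm_ge0.
Qed.

Lemma dist_set_ge0 (R : realType) k (A : set 'cV[R]_k) (x : 'cV[R]_k) :
  0 <= dist_set A x.
Proof.
have [->|/set0P A0] := eqVneq A set0; first by rewrite /dist_set image_set0 inf0.
apply: lb_le_inf; first exact: (dist_set_has_inf x A0).1.
by move=> _ [z _ <-]; exact: enorm_ge0.
Qed.

Lemma dist_set_le (R : realType) k (A : set 'cV[R]_k) (x y : 'cV[R]_k) :
  A y -> dist_set A x <= enorm (x - y).
Proof.
move=> Ay; apply: ge_inf; last by exists y.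
by apply: (dist_set_has_inf x _).2; exists y.
Qed.

Lemma dist_set_lip (R : realType) k (A : set 'cV[R]_k) (x y : 'cV[R]_k) :
  A !=set0 -> dist_set A x <= dist_set A y + enorm (x - y).
Proof.
move=> A0; rewrite -lerBlDr; apply: lb_le_inf.
  exact: (dist_set_has_inf y A0).1.
move=> _ [z Az <-]; rewrite lerBlDr addrC.
exact: le_trans (dist_set_le x Az) (enormB_tri _ _ _).
Qed.

Lemma dist_set_continuous (R : realType) k (A : set 'cV[R]_k) :
  A !=set0 -> continuous (dist_set A).
Proof.
move=> A0 x; apply/(@cvgrPdist_lt _ _ _ (nbhs x)) => e e0.
have := near_enorm x e0; apply: filterS => y; apply: le_lt_trans.
rewrite ler_norml; have := dist_set_lip x y A0; have := dist_set_lip y x A0.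
by rewrite (enormBC y x) => ? ?; apply/andP; split; lra.
Qed.

Lemma dist_set_attained (R : realType) k (A : set 'cV[R]_k) (x : 'cV[R]_k) :
  compact A -> A !=set0 -> exists2 y, A y & enorm (x - y) = dist_set A x.
Proof.
move=> cA A0.
have cE : {within A, continuous (fun y => enorm (x - y))}.
  apply: continuous_subspaceT => y; apply: continuous_comp; last first.
    exact: enorm_continuous.
  apply: (@continuousB _ _ _ (cst x) id); last exact: cvg_id.
  exact: cst_continuous.
have [c /[!inE] Ac H] := compact_EVT_min A0 cA cE.
exists c => //; apply/eqP; rewrite eq_le dist_set_le// andbT.
apply: lb_le_inf; first exact: (dist_set_has_inf x A0).1.
by move=> _ [z Az <-]; apply: H; rewrite inE.
Qed.

Lemma dist_set_eq0 (R : realType) k (A : set 'cV[R]_k) (x : 'cV[R]_k) :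
  compact A -> A !=set0 -> dist_set A x = 0 -> A x.
Proof.
move=> cA A0 dx; have [y Ay] := dist_set_attained x cA A0.
by rewrite dx => /enorm_eq0/eqP; rewrite subr_eq0 => /eqP ->.
Qed.

Lemma compact_dist_set_le (R : realType) k (A : set 'cV[R]_k) (s : R) :
  compact A -> A !=set0 -> compact [set x | dist_set A x <= s].
Proof.
move=> cA A0; have [M AM] := compact_enorm_bound cA.
apply: (@cV_bounded_closed_compact _ _ _ (s + M)).
  move=> x /= dx; have [y Ay xy] := dist_set_attained x cA A0.
  have := enormD (x - y) y; rewrite subrK xy; have := AM _ Ay; lra.
apply: (@closed_comp _ _ (dist_set A) [set r | r <= s]).
  by move=> x _; exact: dist_set_continuous.
exact: closed_le.
Qed.

(** * From uniform asymptotic stability to a KL bound *)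

(** A cutoff of slope 2, equal to 0 up to 1/2 and to 1 from 1 on. At [r / d0 p], with [d0 p]
    positive, it is a Lipschitz substitute for the indicator of [d0 p <= r]. *)
Definition ramp (R : realType) (x : R) : R := Num.max 0 (Num.min 1 (2 * x - 1)).

Lemma ramp_ge0 (R : realType) (x : R) : 0 <= ramp x.
Proof. by rewrite /ramp le_max lexx. Qed.

Lemma ramp_le1 (R : realType) (x : R) : ramp x <= 1.
Proof. by rewrite /ramp ge_max ler01 ge_min lexx. Qed.

Lemma ramp_eq1 (R : realType) (x : R) : 1 <= x -> ramp x = 1.
Proof.
by move=> x1; rewrite /ramp min_l ?max_r//; lra.
Qed.

Lemma ramp_eq0 (R : realType) (x : R) : x <= 1 / 2 -> ramp x = 0.
Proof. by move=> x1; rewrite /ramp max_l// ge_min; apply/orP; right; lra. Qed.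

Lemma ramp_le (R : realType) (x y : R) : x <= y -> ramp x <= ramp y.
Proof.
move=> xy; rewrite /ramp.
case: (leP 1 (2 * x - 1)) => ?; case: (leP 1 (2 * y - 1)) => ?;
case: (leP 0 (2 * x - 1)) => ?; case: (leP 0 (2 * y - 1)) => ?;
by rewrite ?(max_r ler01); lra.
Qed.

Lemma ramp_lip (R : realType) (x y : R) : ramp x <= ramp y + 2 * `|x - y|.
Proof.
have [xy|yx] := leP x y.
  by apply: (le_trans (ramp_le xy)); rewrite lerDl mulr_ge0.
rewrite gtr0_norm ?subr_gt0// /ramp.
case: (leP 1 (2 * x - 1)) => ?; case: (leP 1 (2 * y - 1)) => ?;
case: (leP 0 (2 * x - 1)) => ?; case: (leP 0 (2 * y - 1)) => ?;
by rewrite ?(max_r ler01); lra.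
Qed.

(* The terms with [d0 p > 2 * r] vanish, so this is a regularisation in [r] of
   the supremum of [d1] over the trajectories starting within [r]; since
   [r / 0 = 0], the terms with [d0 p = 0] vanish too. *)
Definition KL_env_set (R : realType) (P : Type) (d0 d1 T : P -> R) (r s : R) :
    set R :=
  [set x | x = 0 \/ exists2 p, s <= T p & x = d1 p * ramp (r / d0 p)].

Definition KL_env (R : realType) (P : Type) (d0 d1 T : P -> R) (r s : R) : R :=
  sup (KL_env_set d0 d1 T r s).

Lemma KL_env_ub (R : realType) (P : Type) (d0 d1 T : P -> R) (r s b : R) :
  (forall p, 0 <= d1 p) -> 0 <= r -> 0 <= b ->
  (forall p, s <= T p -> d0 p <= 2 * r -> d1 p <= b) ->
  ubound (KL_env_set d0 d1 T r s) b.
Proof.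
move=> d1_ge0 r0 b0 H _ [->//|[p sT ->]].
have [pr|rp] := leP (d0 p) (2 * r).
  by rewrite (le_trans _ (H _ sT pr))// ler_piMr// ramp_le1.
rewrite ramp_eq0 ?mulr0// ler_pdivrMr; last by lra.
by lra.
Qed.

Lemma KL_env_le (R : realType) (P : Type) (d0 d1 T : P -> R) (r s b : R) :
  (forall p, 0 <= d1 p) -> 0 <= r -> 0 <= b ->
  (forall p, s <= T p -> d0 p <= 2 * r -> d1 p <= b) ->
  KL_env d0 d1 T r s <= b.
Proof. by move=> *; apply: ge_sup; [exists 0; left|exact: KL_env_ub]. Qed.

Section KL_bound.
(** An element of [P] stands for a trajectory observed at one instant: [d0] is its initial distance
    to the attractor, [d1] its present distance, [T] the time assigned to it. The last three
    hypotheses are uniform boundedness, uniform attractivity and Lyapunov stability. *)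
Variables (R : realType) (P : Type) (d0 d1 T : P -> R).
Hypothesis d0_ge0 : forall p, 0 <= d0 p.
Hypothesis d1_ge0 : forall p, 0 <= d1 p.
Hypothesis bnd : forall S, exists B, forall p, d0 p <= S -> d1 p <= B.
Hypothesis attr : forall S e, 0 < e ->
  exists N, forall p, d0 p <= S -> N <= T p -> d1 p <= e.
Hypothesis stab : forall e, 0 < e ->
  exists2 d, 0 < d & forall p, d0 p <= d -> d1 p <= e.
Local Notation W := (KL_env d0 d1 T).

Let bnd' S : exists2 B, 0 <= B & forall p, d0 p <= S -> d1 p <= B.
Proof.
have [B HB] := bnd S; exists (Num.max 0 B); first by rewrite le_max lexx.
by move=> p /HB pB; rewrite le_max pB orbT.
Qed.

Let W_has_ub r s : 0 <= r -> has_ubound (KL_env_set d0 d1 T r s).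
Proof.
move=> r0; have [B B0 HB] := bnd' (2 * r); exists B.
by apply: KL_env_ub => // p _; exact: HB.
Qed.

Let W_ge0 r s : 0 <= r -> 0 <= W r s.
Proof. by move=> r0; apply: ub_le_sup; [exact: W_has_ub|left]. Qed.

Let W_ge r s p : 0 <= r -> s <= T p -> d1 p * ramp (r / d0 p) <= W r s.
Proof. by move=> r0 sT; apply: ub_le_sup; [exact: W_has_ub|right; exists p]. Qed.

(** Stability applies with every [e]. These [p] need separate care, since their terms in the
    supremum vanish whatever [d1 p] is. *)
Let d1_eq0 p : d0 p = 0 -> d1 p = 0.
Proof.
move=> p0; apply/eqP; rewrite eq_le d1_ge0 andbT; apply/ler_addgt0Pl => e e0.
have [d dp H] := stab e0; rewrite addr0; apply: H.
by rewrite p0 ltW.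
Qed.

Let W0 s : W 0 s = 0.
Proof.
apply/eqP; rewrite eq_le W_ge0// andbT; apply: KL_env_le => // p _.
rewrite mulr0 => p0; rewrite d1_eq0//; apply/eqP.
by rewrite eq_le p0 d0_ge0.
Qed.

Let W_mono r r' s : 0 <= r -> r <= r' -> W r s <= W r' s.
Proof.
move=> r0 rr'; have r'0 := le_trans r0 rr'.
apply: ge_sup; first by exists 0; left.
move=> _ [->|[p sT ->]]; first exact: W_ge0.
apply: (le_trans _ (W_ge r'0 sT)); apply: ler_wpM2l => //.
by apply: ramp_le; rewrite ler_wpM2r// invr_ge0.
Qed.

Let W_anti r s s' : 0 <= r -> s <= s' -> W r s' <= W r s.
Proof.
move=> r0 ss'; apply: ge_sup; first by exists 0; left.
move=> _ [->|[p sT ->]]; first exact: W_ge0.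
by apply: W_ge => //; exact: le_trans sT.
Qed.

(** Only the terms with [r0 / 2 < d0 p <= 4 * r0] vary: for smaller [d0 p] the ramp is 1 at both
    radii, for larger ones it is 0 at [r']. On that range [d1 p <= B], so the slope is at most 2 B /
    (r0 / 2). *)
Let W_lip r0 s : 0 < r0 -> exists2 L, 0 <= L &
  forall r r', r0 / 2 <= r -> r0 / 2 <= r' -> r' <= 2 * r0 ->
  W r' s <= W r s + L * `|r' - r|.
Proof.
move=> r00; have [B B0 HB] := bnd' (4 * r0); exists (4 * B / r0).
  by rewrite divr_ge0 ?mulr_ge0// ltW.
move=> r r' hr hr' hr'2.
have rp : 0 <= r by lra.
have L0 : 0 <= 4 * B / r0 * `|r' - r|.
  by rewrite mulr_ge0// divr_ge0 ?mulr_ge0// ltW.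
apply: ge_sup; first by exists 0; left.
move=> _ [->|[p sT ->]]; first by rewrite addr_ge0// W_ge0.
apply: (@le_trans _ _ (d1 p * ramp (r / d0 p) + 4 * B / r0 * `|r' - r|));
  last first.
  by rewrite lerD2r W_ge.
have [p0|p0] := eqVneq (d0 p) 0; first by rewrite d1_eq0// !mul0r add0r.
have pp : 0 < d0 p by rewrite lt_neqAle eq_sym p0 d0_ge0.
have [pr|rp0] := leP (d0 p) (r0 / 2).
  rewrite !ramp_eq1 ?lerDl// ler_pdivlMr// mul1r; lra.
have [pr|rp1] := leP (d0 p) (4 * r0); last first.
  rewrite (@ramp_eq0 _ (r' / _)) ?mulr0; last by rewrite ler_pdivrMr//; lra.
  by rewrite addr_ge0// mulr_ge0// ramp_ge0.
apply: le_trans (ler_wpM2l (d1_ge0 p) (ramp_lip (r' / d0 p) (r / d0 p))) _.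
rewrite mulrDr lerD2l -mulrBl normrM normfV (gtr0_norm pp).
have dB := HB _ pr.
have -> : d1 p * (2 * (`|r' - r| / d0 p)) = 2 * (d1 p / d0 p) * `|r' - r|.
  by ring.
apply: ler_wpM2r => //.
rewrite -mulrA; have -> : 4 * (B / r0) = 2 * (B / (r0 / 2)).
  by field; rewrite gt_eqF.
rewrite ler_pM2l//; apply: ler_pM => //; first by rewrite invr_ge0 ltW.
by rewrite lef_pV2 ?posrE ?divr_gt0// ltW.
Qed.

Let W_cont r0 s e : 0 <= r0 -> 0 < e -> exists2 d, 0 < d &
  forall r, 0 <= r -> `|r0 - r| < d -> `|W r0 s - W r s| <= e.
Proof.
move=> r0_ge0 e0; have [r00|r0_gt0] := eqVneq r0 0.
  (* At 0 the Lipschitz constants blow up, and continuity comes from stability. The radius is halved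
     because the supremum at [r] sees starting distances up to 2 r. *)
  have [d dp H] := stab e0; exists (d / 2); first by rewrite divr_gt0.
  move=> r rp; rewrite r00 W0 !sub0r !normrN ger0_norm// ger0_norm ?W_ge0// => rd.
  apply: KL_env_le => // [|p _ p2]; first exact: ltW.
  by apply: H; lra.
have r0p : 0 < r0 by rewrite lt_neqAle eq_sym r0_gt0.
have [L L0 HL] := W_lip s r0p.
exists (Num.min (r0 / 2) (e / (L + 1))).
  by rewrite lt_min !divr_gt0//; lra.
move=> r rp; rewrite lt_min => /andP[h1 h2].
have {h1}[h3 h4] : r0 / 2 <= r /\ r <= 2 * r0.
  by move: h1; rewrite ltr_norml => /andP[? ?]; split; lra.
have Le : L * `|r0 - r| <= e.
  move: h2; rewrite ltr_pdivlMr; last by lra.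
  have := normr_ge0 (r0 - r); nra.
have h5 := HL r r0 h3 ltac:(lra) ltac:(lra).
have h6 := HL r0 r ltac:(lra) h3 h4; rewrite distrC in h6.
by rewrite ler_norml; apply/andP; split; lra.
Qed.

Lemma KL_bound : exists2 beta, class_KL beta &
  forall p, 0 <= T p -> d1 p <= beta (d0 p) (T p).
Proof.
(* The second term makes the bound strictly increasing in [r] and still decays in [s]. The first
   dominates [d1 p], because the ramp is 1 at [d0 p / d0 p]. *)
exists (fun r s => W r s + r / (1 + s)); last first.
  move=> p Tp; have dT : 0 <= d0 p / (1 + T p) by rewrite divr_ge0// addr_ge0.
  rewrite (le_trans _ (_ : W (d0 p) (T p) <= _)) ?lerDl//.
  have [p0|p0] := eqVneq (d0 p) 0; first by rewrite d1_eq0// W_ge0.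
  have := @W_ge (d0 p) (T p) p (d0_ge0 p) (lexx _).
  by rewrite divff// ramp_eq1// mulr1.
split=> [s s0|r r0]; [split|split].
- by rewrite W0 mul0r addr0.
- split=> [|r r' r0 rr']; last first.
    apply: ler_ltD; first by rewrite W_mono// ltW.
    by rewrite ltr_pM2r// invr_gt0; lra.
  apply/subspace_continuousP => r0; rewrite /= in_itv/= andbT => r0_ge0.
  apply/cvgrPdist_le => e e0; have e2 : 0 < e / 2 by rewrite divr_gt0.
  have [d dp Hd] := W_cont s r0_ge0 e2.
  rewrite /prop_near1 /= nbhs_nearE; apply/nbhs_ballP.
  exists (Num.min d (e / 2)) => /=; first by rewrite lt_min dp.
  move=> r; rewrite /ball/= lt_min => /andP[h1 h2]; rewrite in_itv/= andbT => rp.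
  have := Hd _ rp h1.
  have -> : W r0 s + r0 / (1 + s) - (W r s + r / (1 + s)) =
    (W r0 s - W r s) + (r0 - r) / (1 + s) by ring.
  move=> h3; apply: le_trans (ler_normD _ _) _.
  suff : `|(r0 - r) / (1 + s)| <= e / 2 by lra.
  rewrite normrM normfV (@ger0_norm _ (1 + s)); last by lra.
  rewrite ler_pdivrMr; last by lra.
  by apply: le_trans (ltW h2) _; rewrite ler_pMr//; lra.
- move=> s1 s2 s10 s12; apply: lerD; first exact: W_anti.
  by rewrite ler_wpM2l// lef_pV2 ?posrE; lra.
- apply/cvgrPdist_le => e e0; have e2 : 0 < e / 2 by rewrite divr_gt0.
  have [N HN] := attr (2 * r) e2.
  exists (Num.max 0 (Num.max N (2 * r / e))); split; first exact: num_real.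
  move=> s; rewrite !gt_max => /and3P[s0 sN sr].
  rewrite sub0r normrN ger0_norm; last first.
    by rewrite addr_ge0 ?W_ge0// divr_ge0// addr_ge0// ltW.
  have h : W r s <= e / 2.
    apply: KL_env_le => // [|p sT p2]; first exact: ltW.
    by apply: HN => //; rewrite (le_trans _ sT)// ltW.
  suff : r / (1 + s) <= e / 2 by lra.
  rewrite ler_pdivrMr; last by lra.
  by move: sr; rewrite ltr_pdivrMr//; nra.
Qed.

End KL_bound.

(** * The averaged gradient *)

Lemma unit_intE (R : realType) (t : R) : unit_int t = (0 <= t <= 1).
Proof. by rewrite /unit_int/= in_itv. Qed.

Lemma unit_int0 (R : realType) : unit_int (0 : R).
Proof. by rewrite unit_intE lexx ler01. Qed.

Lemma measurable_unit_int (R : realType) : measurable (@unit_int R).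
Proof. exact: measurable_itv. Qed.

Lemma int01_integrable (R : realType) (f : R -> R) :
  {within @unit_int R, continuous f} ->
  (@lebesgue_measure R).-integrable (@unit_int R) (EFin \o f).
Proof.
move=> cf; apply: continuous_compact_integrable => //.
exact: segment_compact.
Qed.

Lemma int01D (R : realType) (f1 f2 : R -> R) :
  {within @unit_int R, continuous f1} -> {within @unit_int R, continuous f2} ->
  int01 (fun t => f1 t + f2 t) = int01 f1 + int01 f2.
Proof.
move=> c1 c2.
by rewrite /int01 RintegralD//; [exact: measurable_unit_int|
  exact: int01_integrable|exact: int01_integrable].
Qed.

Lemma int01Zl (R : realType) (c : R) (f : R -> R) :
  {within @unit_int R, continuous f} ->
  int01 (fun t => c * f t) = c * int01 f.
Proof.
move=> cf.
by rewrite /int01 RintegralZl//; [exact: measurable_unit_int|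
  exact: int01_integrable].
Qed.

Lemma int01B (R : realType) (f1 f2 : R -> R) :
  {within @unit_int R, continuous f1} -> {within @unit_int R, continuous f2} ->
  int01 (fun t => f1 t - f2 t) = int01 f1 - int01 f2.
Proof.
move=> c1 c2.
by rewrite /int01 RintegralB//; [exact: measurable_unit_int|
  exact: int01_integrable|exact: int01_integrable].
Qed.

Lemma within_continuousM (R : realType) (D : set R) (f g : R -> R) :
  {within D, continuous f} -> {within D, continuous g} ->
  {within D, continuous (fun t => f t * g t)}.
Proof.
move=> cf cg t.
by apply: (@continuousM _ (subspace D) f g); [exact: cf|exact: cg].
Qed.

Lemma within_continuousB (R : realType) (D : set R) (f g : R -> R) :
  {within D, continuous f} -> {within D, continuous g} ->
  {within D, continuous (fun t => f t - g t)}.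
Proof.
move=> cf cg t.
by apply: (@continuousB _ _ (subspace D) f g); [exact: cf|exact: cg].
Qed.

Lemma within_continuous_cst (R : realType) (D : set R) (c : R) :
  {within D, continuous (fun=> c)}.
Proof. by move=> t; exact: cst_continuous. Qed.

Lemma within_continuous_sum (R : realType) (D : set R) k (f : 'I_k -> R -> R) :
  (forall i, {within D, continuous (f i)}) ->
  {within D, continuous (fun t => \sum_(i < k) f i t)}.
Proof.
elim: k f => [|k IH] f cf.
  under eq_fun do rewrite big_ord0.
  by move=> t; exact: cst_continuous.
under eq_fun do rewrite big_ord_recl.
move=> t; apply: continuousD; first exact: cf.
by apply: IH => i; exact: cf.
Qed.

Lemma int01_cst (R : realType) (c : R) : int01 (fun=> c) = c.
Proof.
rewrite /int01 Rintegral_cst; last exact: measurable_unit_int.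
suff -> : fine (lebesgue_measure (@unit_int R)) = 1 by rewrite mulr1.
by rewrite /unit_int (@lebesgue_measure_itv R `[0, 1]) /= lte_fin ltr01 sube0.
Qed.

Lemma int01_sum (R : realType) k (f : 'I_k -> R -> R) :
  (forall i, {within @unit_int R, continuous (f i)}) ->
  int01 (fun t => \sum_(i < k) f i t) = \sum_(i < k) int01 (f i).
Proof.
elim: k f => [|k IH] f cf.
  by under eq_fun do rewrite big_ord0; rewrite int01_cst big_ord0.
under eq_fun do rewrite big_ord_recl.
rewrite int01D ?big_ord_recl ?IH//.
by apply: within_continuous_sum => i; exact: cf.
Qed.

Lemma int01_norm_le (R : realType) (f : R -> R) (c : R) :
  {within @unit_int R, continuous f} ->
  (forall t, unit_int t -> `|f t| <= c) -> `|int01 f| <= c.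
Proof.
move=> cf fc; have ccst b : {within @unit_int R, continuous (fun=> b : R)}.
  by move=> t; exact: cst_continuous.
rewrite ler_norml -[X in X <= _ <= _]int01_cst -[X in _ <= _ <= X]int01_cst.
by apply/andP; split; apply: le_Rintegral;
  try (exact: measurable_unit_int || exact: int01_integrable);
  move=> t /fc; rewrite ler_norml => /andP[].
Qed.

Lemma is_derive_line (R : realType) n (phi : 'cV[R]_n -> R) grad (y w : 'cV[R]_n)
    (s : R) : is_gradient phi grad ->
  is_derive s 1 (fun s : R => phi (y + s *: w)) (dotv (grad (y + s *: w)) w).
Proof.
move=> H; have [dphi <-] := H (y + s *: w).
have E : (fun h : R => h^-1 *: (((fun s : R => phi (y + s *: w)) \o shift s)
    (h *: 1) - phi (y + s *: w))) =
    (fun h : R => h^-1 *: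
      ((phi \o shift (y + s *: w)) (h *: w) - phi (y + s *: w))).
  by apply/funext => h /=; rewrite -[h *: (1 : R)]/(h * 1) mulr1 scalerDl addrCA.
apply: DeriveDef; rewrite /derivable /derive E.
  exact: diff_derivable.
exact: deriveE.
Qed.

Lemma gradient_MVT (R : realType) n (phi : 'cV[R]_n -> R) grad (x y : 'cV[R]_n) :
  is_gradient phi grad -> exists2 s : R, 0 <= s <= 1 &
  phi x - phi y = dotv (grad (y + s *: (x - y))) (x - y).
Proof.
move=> H; pose f (s : R) := phi (y + s *: (x - y)).
pose df (s : R) := dotv (grad (y + s *: (x - y))) (x - y).
have Hd (s : R) : is_derive s (1 : R) f (df s) by exact: is_derive_line.
have cf : {within `[0, 1], continuous f}.
  apply: continuous_subspaceT => s.
  apply: differentiable_continuous; apply/derivable1_diffP.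
  exact: (@ex_derive _ _ _ _ _ _ _ (Hd s)).
have [s s01] := @MVT _ f df 0 1 ltr01 (fun s _ => Hd s) cf.
rewrite /f scale1r scale0r addr0 (addrC y (x - y)) subrK subr0 mulr1 => E.
by exists s => //; move: s01; rewrite in_itv/= => /andP[/ltW -> /ltW ->].
Qed.

(** The mean value point is within [enorm (x - y)] of [y], which gives the constant L instead of the
    L/2 of the integral form. No sign of L is assumed: [HL x y] itself yields
    [0 <= L * enorm (x - y)]. *)
Lemma gradient_taylor (R : realType) n (phi : 'cV[R]_n -> R) grad (L : R)
    (x y : 'cV[R]_n) : is_gradient phi grad ->
  (forall u1 u2, enorm (grad u1 - grad u2) <= L * enorm (u1 - u2)) ->
  `|phi x - phi y - dotv (grad y) (x - y)| <= L * enorm (x - y) ^+ 2.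
Proof.
move=> H HL; have [s /andP[s0 s1] ->] := gradient_MVT x y H.
rewrite -dotvBl; apply: le_trans (normr_dotv _ _) _.
have := HL (y + s *: (x - y)) y; rewrite addrAC subrr add0r enormZ ger0_norm//.
have := le_trans (enorm_ge0 _) (HL x y).
have := enorm_ge0 (x - y).
set a := enorm (x - y); set b := enorm (_ - _) => a0 La bLa.
rewrite expr2 mulrA; apply: ler_wpM2r => //; apply: le_trans bLa _.
by rewrite mulrCA ler_piMl.
Qed.

Lemma UPE_coord_continuous (R : realType) n (v : R -> 'cV[R]_n) i :
  UPE v -> {within @unit_int R, continuous (fun t => v t i 0)}.
Proof.
move=> [cv _]; apply: (@within_continuous_comp _ _ _ _ v (fun u => u i 0)) => //.
by move=> u _; exact: coord_continuous.
Qed.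

Lemma UPE_shift_continuous (R : realType) n (v : R -> 'cV[R]_n)
    (phi : 'cV[R]_n -> R) (a : R) (u : 'cV[R]_n) : UPE v -> continuous phi ->
  {within @unit_int R, continuous (fun t => phi (u + a *: v t))}.
Proof.
move=> [cv _] cphi.
apply: (@within_continuous_comp _ _ _ _ v (fun w => phi (u + a *: w))) => //.
move=> w _; apply: continuous_comp; last exact: cphi.
apply: continuousD; first exact: cst_continuous.
exact: scaler_continuous.
Qed.

Lemma UPE_has_sup (R : realType) n (v : R -> 'cV[R]_n) : UPE v ->
  has_sup [set enorm (v t) | t in @unit_int R].
Proof.
move=> [cv _]; split; first by exists (enorm (v 0)), 0 => //; exact: unit_int0.
have [M HM] :=
  compact_enorm_bound (continuous_compact cv (@segment_compact R 0 1)).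
by exists M => _ [t t01 <-]; apply: HM; exists t.
Qed.

Lemma enorm_le_M_v (R : realType) n (v : R -> 'cV[R]_n) (t : R) : UPE v ->
  unit_int t -> enorm (v t) <= M_v v.
Proof. by move=> /UPE_has_sup hs t01; apply: sup_upper_bound => //; exists t. Qed.

Lemma M_v_ge0 (R : realType) n (v : R -> 'cV[R]_n) : UPE v -> 0 <= M_v v.
Proof.
move=> uv; apply: le_trans (enorm_ge0 (v 0)) _; apply: enorm_le_M_v => //.
exact: unit_int0.
Qed.

(* A negative Lipschitz constant is only possible in dimension 0. *)
Lemma lip_ge0_or_M_v0 (R : realType) n (F : 'cV[R]_n -> 'cV[R]_n) (L : R)
    (v : R -> 'cV[R]_n) :
  (forall u1 u2, enorm (F u1 - F u2) <= L * enorm (u1 - u2)) ->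
  0 <= L \/ M_v v = 0.
Proof.
move=> HL; have [L0|L0] := leP 0 L; [by left|right].
have E0 (w : 'cV[R]_n) : enorm w = 0.
  have := le_trans (enorm_ge0 _) (HL w 0); rewrite subr0 nmulr_rge0// => w0.
  by apply/eqP; rewrite eq_le w0 enorm_ge0.
rewrite /M_v (_ : image _ _ = [set 0]) ?sup1//.
apply/seteqP; split => [_ [t _ <-]//|_ ->].
by exists 0 => //; exact: unit_int0.
Qed.

Lemma is_gradient_continuous (R : realType) n (phi : 'cV[R]_n -> R) grad :
  is_gradient phi grad -> continuous phi.
Proof. by move=> H u; apply: differentiable_continuous; have [] := H u. Qed.

(* By the moment conditions, replacing [phi] by its first-order Taylor
   remainder at [u] subtracts exactly the gradient. *)
Lemma Phibar_sub_grad (R : realType) n (phi : 'cV[R]_n -> R) grad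
    (v : R -> 'cV[R]_n) (a : R) (u : 'cV[R]_n) i :
  is_gradient phi grad -> UPE v -> a != 0 ->
  (Phibar phi v a u - grad u) i 0 = a^-1 *
    int01 (fun t =>
      (phi (u + a *: v t) - phi u - a * dotv (grad u) (v t)) * v t i 0).
Proof.
move=> H uv a0; have cphi := is_gradient_continuous H.
have cc j := @UPE_coord_continuous R n v j uv.
have cp := @UPE_shift_continuous R n v phi a u uv cphi.
have [_ [v0 v1]] := uv.
have -> : (fun t =>
    (phi (u + a *: v t) - phi u - a * dotv (grad u) (v t)) * v t i 0)
  = (fun t => (phi (u + a *: v t) * v t i 0 - phi u * v t i 0) -
      \sum_(j < n) (a * grad u j 0) * (v t j 0 * v t i 0)).
  apply/funext => t; rewrite !mulrBl /dotv mulr_sumr mulr_suml.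
  by congr (_ - _); apply: eq_bigr => j _; ring.
have c1 : {within @unit_int R, continuous
    (fun t => phi (u + a *: v t) * v t i 0)}.
  by apply: within_continuousM; [exact: cp|exact: cc].
have c2 : {within @unit_int R, continuous (fun t => phi u * v t i 0)}.
  by apply: within_continuousM; [exact: within_continuous_cst|exact: cc].
have c3 j : {within @unit_int R, continuous (fun t => v t j 0 * v t i 0)}.
  by apply: within_continuousM; exact: cc.
have c4 j : {within @unit_int R, continuous
    (fun t => (a * grad u j 0) * (v t j 0 * v t i 0))}.
  by apply: within_continuousM; [exact: within_continuous_cst|exact: c3].
rewrite int01B; last 2 first.
- by apply: within_continuousB; [exact: c1|exact: c2].
- exact: within_continuous_sum.
rewrite int01B// int01Zl// v0 mulr0 subr0 int01_sum//.
under eq_bigr => j _ do rewrite int01Zl// v1.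
rewrite (bigD1 i)//= eqxx mulr1 big1 ?addr0; last first.
  by move=> j /negPf ->; rewrite mulr0.
by rewrite !mxE mulrBr mulKf.
Qed.

Lemma Phibar_error (R : realType) n (phi : 'cV[R]_n -> R) grad (L : R)
    (v : R -> 'cV[R]_n) (a : R) (u : 'cV[R]_n) :
  is_gradient phi grad ->
  (forall u1 u2, enorm (grad u1 - grad u2) <= L * enorm (u1 - u2)) ->
  UPE v -> 0 < a ->
  enorm (Phibar phi v a u - grad u) <= M_v v ^+ 3 * L * a.
Proof.
move=> H HL uv a0; have M0 := M_v_ge0 uv; have LM := lip_ge0_or_M_v0 v HL.
have cphi := is_gradient_continuous H.
have cc j := @UPE_coord_continuous R n v j uv.
have cp := @UPE_shift_continuous R n v phi a u uv cphi.
set e := Phibar _ _ _ _ - _; set M := M_v v in M0 LM *.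
pose psi t := phi (u + a *: v t) - phi u - a * dotv (grad u) (v t).
have MLa : 0 <= M ^+ 3 * L * a.
  case: LM => [L0|->]; last by rewrite expr0n/= !mul0r.
  by rewrite !mulr_ge0// ?exprn_ge0// ltW.
have psiM t : unit_int t -> `|psi t| <= L * M ^+ 2 * a ^+ 2.
  move=> t01; have := gradient_taylor (u + a *: v t) u H HL.
  rewrite (addrAC u (a *: v t)) subrr add0r dotvZr enormZ (gtr0_norm a0).
  move=> /le_trans; apply.
  have := enorm_le_M_v uv t01; rewrite -/M => vM; have v0 := enorm_ge0 (v t).
  rewrite exprMn [a ^+ 2 * _]mulrC mulrA; apply: ler_wpM2r; first exact: sqr_ge0.
  case: LM => [L0|M00]; first by apply: ler_wpM2l => //; rewrite ler_sqr ?nnegrE.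
  have -> : enorm (v t) = 0 by apply/eqP; rewrite eq_le v0 -M00 vM.
  by rewrite M00.
have cpsi : {within @unit_int R, continuous psi}.
  have cd : {within @unit_int R, continuous (fun t => dotv (grad u) (v t))}.
    apply: within_continuous_sum => j; apply: within_continuousM; last exact: cc.
    exact: within_continuous_cst.
  apply: within_continuousB; first apply: within_continuousB; first exact: cp.
    exact: within_continuous_cst.
  by apply: within_continuousM; [exact: within_continuous_cst|exact: cd].
have cpv i : {within @unit_int R, continuous (fun t => psi t * v t i 0)}.
  by apply: within_continuousM; [exact: cpsi|exact: cc].
have eE i : e i 0 = a^-1 * int01 (fun t => psi t * v t i 0).
  by rewrite /e Phibar_sub_grad// gt_eqF.
(* The error is paired with itself under the integral and one factor [enorm e] is cancelled at the
   end. Bounding each coordinate separately would bring in a factor depending on the dimension. *)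
have E : dotv e e = a^-1 * int01 (fun t => psi t * dotv (v t) e).
  rewrite {1}/dotv.
  under eq_bigr => i _ do rewrite {1}eE -mulrA (mulrC (int01 _)) -int01Zl//.
  rewrite -mulr_sumr -int01_sum; last first.
    move=> i; apply: within_continuousM; last exact: cpv.
    exact: within_continuous_cst.
  congr (_ * int01 _); apply/funext => t.
  rewrite [dotv (v t) e]/dotv [RHS]mulr_sumr.
  by apply: eq_bigr => i _; rewrite [LHS]mulrC -mulrA.
have [->//|e0] := eqVneq (enorm e) 0.
have ep : 0 < enorm e by rewrite lt_neqAle eq_sym e0 enorm_ge0.
rewrite -(ler_pM2r ep) -expr2 sqr_enorm E.
apply: le_trans (ler_norm _) _.
rewrite normrM normfV (gtr0_norm a0) ler_pdivrMl//.
apply: int01_norm_le.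
  have cd : {within @unit_int R, continuous (fun t => dotv (v t) e)}.
    apply: within_continuous_sum => j; apply: within_continuousM; first exact: cc.
    exact: within_continuous_cst.
  by apply: within_continuousM; [exact: cpsi|exact: cd].
move=> t t01; rewrite normrM.
apply: (@le_trans _ _ ((L * M ^+ 2 * a ^+ 2) * (M * enorm e))); last first.
  by rewrite le_eqVlt; apply/orP; left; apply/eqP; ring.
apply: ler_pM => //; first exact: psiM.
apply: le_trans (normr_dotv _ _) _; apply: ler_wpM2r; first exact: enorm_ge0.
exact: enorm_le_M_v.
Qed.

(** Near u, phi is Lipschitz at all the points u + a v(t) with one common constant, so the
    integrands are uniformly close. *)
Lemma Phibar_continuous (R : realType) n (phi : 'cV[R]_n -> R) grad (L : R)
    (v : R -> 'cV[R]_n) (a : R) :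
  is_gradient phi grad ->
  (forall u1 u2, enorm (grad u1 - grad u2) <= L * enorm (u1 - u2)) ->
  UPE v -> 0 < a -> continuous (Phibar phi v a).
Proof.
move=> H HL uv a0 u; have M0 := M_v_ge0 uv; set M := M_v v in M0 *.
have cphi := is_gradient_continuous H.
have cc j := @UPE_coord_continuous R n v j uv.
have cp w := @UPE_shift_continuous R n v phi a w uv cphi.
(* The first two terms bound the gradient at every u + a v(t). The third absorbs the Taylor
   remainder, as |L| d^2 <= |L| d for d < 1. *)
pose C := enorm (grad u) + `|L| * (a * M) + `|L|.
have C0 : 0 <= C.
  apply: addr_ge0 => //; apply: addr_ge0; first exact: enorm_ge0.
  by rewrite !mulr_ge0// ltW.
have phi_lip w t : unit_int t -> enorm (u - w) < 1 ->
    `|phi (u + a *: v t) - phi (w + a *: v t)| <= C * enorm (u - w).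
  move=> t01 uw1; set x := w + _; set y := u + _.
  have xy : x - y = w - u by rewrite /x /y opprD addrACA subrr addr0.
  have := gradient_taylor x y H HL.
  have gy : enorm (grad y) <= enorm (grad u) + `|L| * (a * M).
    rewrite -[grad y](subrK (grad u)); apply: le_trans (enormD _ _) _.
    rewrite addrC lerD2l; apply: le_trans (HL _ _) _.
    rewrite /y addrAC subrr add0r enormZ gtr0_norm//.
    apply: (@le_trans _ _ (`|L| * (a * enorm (v t)))).
      by rewrite ler_wpM2r ?ler_norm// mulr_ge0 ?enorm_ge0// ltW.
    by rewrite ler_wpM2l// ler_pM2l// enorm_le_M_v.
  rewrite xy => T; rewrite distrC.
  have := normr_dotv (grad y) (w - u).
  rewrite (enormBC u w) in uw1 *; have := enorm_ge0 (w - u).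
  move: T gy uw1; set d := enorm (w - u) => T gy d1 d0 D.
  have LL : L * d ^+ 2 <= `|L| * d.
    apply: (@le_trans _ _ (`|L| * d ^+ 2)).
      by rewrite ler_wpM2r ?sqr_ge0// ler_norm.
    by rewrite ler_wpM2l// expr2 ler_piMl// ltW.
  have gd : enorm (grad y) * d <= (enorm (grad u) + `|L| * (a * M)) * d.
    by rewrite ler_wpM2r.
  rewrite -[phi x - phi y](subrK (dotv (grad y) (w - u))).
  apply: le_trans (ler_normD _ _) _; rewrite /C mulrDl; lra.
apply/(@cvgrPdist_le _ _ _ (nbhs u)) => e e0.
have C1 : 0 < a^-1 * (C * M) + 1.
  by rewrite ltr_wpDl// mulr_ge0 ?mulr_ge0// invr_ge0 ltW.
have ee : 0 < Num.min 1 (e / (a^-1 * (C * M) + 1)).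
  by rewrite lt_min ltr01 divr_gt0.
have := near_enorm u ee; apply: filterS => w; rewrite lt_min => /andP[uw1 uwe].
apply: normr_mx_le => [|i j]; first exact: ltW.
rewrite ord1 /Phibar -scalerBr !mxE -int01B; last 2 first.
- by apply: within_continuousM; [exact: cp|exact: cc].
- by apply: within_continuousM; [exact: cp|exact: cc].
rewrite normrM normfV (gtr0_norm a0).
apply: (@le_trans _ _ (a^-1 * (C * enorm (u - w) * M))); last first.
  move: uwe; rewrite ltr_pdivlMr// => /ltW uwe; apply: le_trans uwe.
  rewrite mulrDr mulr1 -[leLHS]addr0 lerD ?enorm_ge0//.
  by rewrite le_eqVlt; apply/orP; left; apply/eqP; ring.
rewrite ler_pM2l ?invr_gt0//; apply: int01_norm_le.
  by apply: within_continuousB; apply: within_continuousM;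
    try exact: cc; exact: cp.
move=> t t01; rewrite -mulrBl normrM; apply: ler_pM => //; first exact: phi_lip.
exact: le_trans (coord_le_enorm _ _) (enorm_le_M_v uv t01).
Qed.

(** * Omega-limit sets of practically stable maps *)

Lemma compact_seq_cluster (X : topologicalType) (K : set X) (z : nat -> X) :
  compact K -> (forall k, K (z k)) ->
  exists2 y, K y & forall U N, nbhs y U -> exists2 k, (N <= k)%N & U (z k).
Proof.
move=> cK Kz.
have [|y [Ky cy]] := cK (z @ \oo) _; first by exists 0%N => //= k _; exact: Kz.
exists y => // U N yU.
have zN : (z @ \oo) [set z k | k in [set k | (N <= k)%N]].
  by exists N => //= k Nk; exists k.
by have [_ [[k Nk <-] Uk]] := cy _ _ zN yU; exists k.
Qed.

(** The omega-limit of the set as a whole: the starting point may change with [k]. It can be larger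
    than the union of the omega-limits of single points, and this is what makes attraction uniform
    over K. *)
Definition omega_limit (X : topologicalType) (G : X -> X) (K : set X) : set X :=
  \bigcap_N closure
    [set y | exists2 k, (N <= k)%N & exists2 x, K x & y = iter k G x].

Lemma omega_limitP (X : topologicalType) (G : X -> X) (K : set X) (y : X) :
  omega_limit G K y <-> forall U N, nbhs y U ->
    exists2 k, (N <= k)%N & exists2 x, K x & U (iter k G x).
Proof.
split=> [H U N yU|H N _ U yU].
  have [_ [[k Nk [x Kx ->]] Ux]] := H N I U yU.
  by exists k => //; exists x.
have [k Nk [x Kx Ux]] := H U N yU.
by exists (iter k G x); split => //; exists k => //; exists x.
Qed.

Lemma omega_limit_closed (X : topologicalType) (G : X -> X) (K : set X) :
  closed (omega_limit G K).
Proof. by apply: closed_bigI => N _; exact: closed_closure. Qed.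

Lemma omega_limit_invariant (X : topologicalType) (G : X -> X) (K : set X)
    (y : X) :
  continuous G -> omega_limit G K y -> omega_limit G K (G y).
Proof.
move=> cG /omega_limitP H; apply/omega_limitP => U N yU.
have [k Nk [x Kx Ux]] := H _ N (cG _ _ yU).
by exists k.+1; [exact: leqW|exists x].
Qed.

Section omega_attractor.
Variables (R : realType) (n : nat) (G : 'cV[R]_n -> 'cV[R]_n).
Variables (A : set 'cV[R]_n) (r : R) (beta : R -> R -> R).
Hypothesis cG : continuous G.
Hypothesis cA : compact A.
Hypothesis A0 : A !=set0.
Hypothesis r0 : 0 <= r.
Hypothesis KLb : class_KL beta.
Hypothesis practical : forall x k,
  dist_set A (iter k G x) <= beta (dist_set A x) k%:R + r.

(** The slack 1 makes [K] absorb every bounded set of initial points, since the beta term eventually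
    drops below 1. It also puts all points within 1 of [O] into [K]. *)
Let K := [set x | dist_set A x <= r + 1].
Let O := omega_limit G K.
Local Notation d := (dist_set O).

Let beta_le (s S : R) k : 0 <= s -> s <= S -> beta s k%:R <= beta S k%:R.
Proof.
move=> s0; rewrite le_eqVlt => /predU1P[->//|sS].
by have [_ [_ m]] := KLb.1 k%:R (ler0n _ _); exact/ltW/m.
Qed.

Let beta_le0 (S : R) k : 0 <= S -> beta S k%:R <= beta S 0.
Proof. by move=> S0; apply: (KLb.2 S S0).1. Qed.

Let beta_small (S e : R) : 0 <= S -> 0 < e ->
  exists N, forall k, (N <= k)%N -> beta S k%:R <= e.
Proof.
move=> S0 e0; have [_ /cvgrPdist_le/(_ _ e0)[M [_ HM]]] := KLb.2 S S0.
exists (Num.Def.trunc `|M|).+1 => k Nk.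
have Mk : M < k%:R.
  apply: le_lt_trans (ler_norm M) _; apply: lt_le_trans (truncnS_gt _) _.
  by rewrite ler_nat.
by have := HM _ Mk; rewrite sub0r normrN; apply: le_trans; exact: ler_norm.
Qed.

Let K_compact : compact K.
Proof. exact: compact_dist_set_le. Qed.

Let absorb (S : R) : 0 <= S -> exists N, forall x k, dist_set A x <= S ->
  (N <= k)%N -> K (iter k G x).
Proof.
move=> S0; have [N HN] := beta_small S0 ltr01; exists N => x k xS Nk.
have := practical x k; have := beta_le k (dist_set_ge0 A x) xS; have := HN k Nk.
rewrite /K/=; lra.
Qed.

(** A point of [O] is approached by arbitrarily late iterates from [K], for which the beta term is
    negligible; so the slack 1 disappears. *)
Let O_dist x : O x -> dist_set A x <= r.
Proof.
move=> /omega_limitP Ox; apply/ler_addgt0Pl => e e0.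
have e2 : 0 < e / 2 by rewrite divr_gt0.
have r1 : 0 <= r + 1 by rewrite addr_ge0.
have [N HN] := beta_small r1 e2.
have [k Nk [y Ky xy]] := Ox _ N (near_enorm x e2).
have := dist_set_lip x (iter k G y) A0; have := practical y k.
have := beta_le k (dist_set_ge0 A y) Ky; have := HN k Nk.
move: xy => /=; lra.
Qed.

Let O_K : O `<=` K.
Proof. by move=> x /O_dist xr; rewrite /K/=; lra. Qed.

Let O_compact : compact O.
Proof. exact: subclosed_compact (@omega_limit_closed _ G K) K_compact O_K. Qed.

Let O_nonempty : O !=set0.
Proof.
have [a Aa] := A0.
have aA : dist_set A a <= r + 1.
  by apply: le_trans (dist_set_le a Aa) _; rewrite subrr enorm0 addr_ge0.
have r1 : 0 <= r + 1 by rewrite addr_ge0.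
have [N HN] := absorb r1.
(* The orbit is shifted by [N] so that it stays in the compact [K] from its first term on. *)
have [y _ Hy] := @compact_seq_cluster _ _ (fun k => iter (N + k) G a) K_compact
  (fun k => HN a (N + k)%N aA (leq_addr _ _)).
exists y; apply/omega_limitP => U M yU; have [k Mk Uk] := Hy U M yU.
exists (N + k)%N; last by exists a.
by rewrite (leq_trans Mk)// leq_addl.
Qed.

Let O_inflate : O `<=` inflate A r.
Proof.
move=> x /O_dist xr; have [y Ay xy] := dist_set_attained x cA A0.
by exists y => //; rewrite xy.
Qed.

(** With [dist_le_A], the distances to [A] and to [O] differ by bounded amounts, so a bound on one
    is a bound on the other. *)
Let distA_le x : dist_set A x <= d x + r.
Proof.
have [y Oy <-] := dist_set_attained x O_compact O_nonempty.
by have := dist_set_lip x y A0; have := O_dist Oy; lra.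
Qed.

Let dist_le_A : exists C, forall x, d x <= dist_set A x + C.
Proof.
have [M1 H1] := compact_enorm_bound cA; have [b Ob] := O_nonempty.
exists (M1 + enorm b) => x; have [y Ay <-] := dist_set_attained x cA A0.
have := dist_set_le x Ob; have := enormB_tri x b y.
have := enormD y (- b); rewrite enormN; have := H1 _ Ay; lra.
Qed.

Let bounded (S : R) : exists B, forall x k, d x <= S -> d (iter k G x) <= B.
Proof.
have [C HC] := dist_le_A; have [S0|S0] := leP 0 S; last first.
  by exists 0 => x k xS; have := dist_set_ge0 O x; lra.
exists (beta (S + r) 0 + r + C) => x k xS.
have Sr : 0 <= S + r by rewrite addr_ge0.
have xA : dist_set A x <= S + r by have := distA_le x; lra.
have := HC (iter k G x); have := practical x k.
have := beta_le k (dist_set_ge0 A x) xA; have := beta_le0 k Sr; lra.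
Qed.

(** Otherwise there are ever later iterates from [K] at distance more than [e] from [O]. They
    cluster in the compact [K], and a cluster point of such iterates is in [O] by definition. *)
Let attract_K (e : R) : 0 < e ->
  exists N, forall x k, K x -> (N <= k)%N -> d (iter k G x) <= e.
Proof.
move=> e0; apply: contrapT => /forallNP H.
have r1 : 0 <= r + 1 by rewrite addr_ge0.
have [N HN] := absorb r1.
(* Times at least [N + i] serve two ends: beyond [N] the iterates lie in [K], and with [i] they tend
   to infinity. *)
have HH i : exists p : 'cV[R]_n * nat,
    [/\ K p.1, (N + i <= p.2)%N & e < d (iter p.2 G p.1)].
  apply: contrapT => Hi; apply: (H (N + i)%N) => x k Kx ik.
  rewrite leNgt; apply/negP => ek; apply: Hi; exists (x, k); split => //.
have [p Hp] := choice HH.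
have pK i : K (iter (p i).2 G (p i).1).
  have [Kp Np _] := Hp i; apply: HN => //.
  exact: leq_trans (leq_addr _ _) Np.
have [y _ Hy] := compact_seq_cluster K_compact pK.
have Oy : O y.
  apply/omega_limitP => U M yU; have [i Mi Ui] := Hy U M yU.
  have [Kp Np _] := Hp i; exists (p i).2; last by exists (p i).1.
  by apply: leq_trans Np; rewrite (leq_trans Mi)// leq_addl.
have [i _ /= yi] := Hy _ 0%N (near_enorm y e0).
have [_ _ ] := Hp i; apply/negP; rewrite -leNgt.
apply: le_trans (dist_set_le _ Oy) _.
by rewrite enormBC ltW.
Qed.

Let attract (S e : R) : 0 < e ->
  exists N, forall x k, d x <= S -> (N <= k)%N -> d (iter k G x) <= e.
Proof.
move=> e0; have [S0|S0] := leP 0 S; last first.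
  by exists 0%N => x k xS; have := dist_set_ge0 O x; lra.
have Sr : 0 <= S + r by rewrite addr_ge0.
have [N1 H1] := absorb Sr; have [N2 H2] := attract_K e0.
exists (N2 + N1)%N => x k xS Nk.
have -> : k = ((k - N1) + N1)%N by lia.
rewrite iterD; apply: H2; last by lia.
by apply: H1 => //; have := distA_le x; lra.
Qed.

(** Otherwise points tending to [O] have images that stay [e] away from it. A cluster point [y] of
    these points is in [O], hence so is [G y], and continuity at [y] gives a contradiction. *)
Let stable_step (e : R) : 0 < e ->
  exists2 c, 0 < c & forall x, d x <= c -> d (G x) <= e.
Proof.
move=> e0; apply: contrapT => H.
have HH i : exists x, d x <= i.+1%:R^-1 /\ e < d (G x).
  apply: contrapT => Hi; apply: H; exists (i.+1%:R^-1).
    by rewrite invr_gt0 ltr0n.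
  move=> x xi; rewrite leNgt; apply/negP => ex; apply: Hi.
  by exists x.
have [x Hx] := choice HH.
have xK i : K (x i).
  have [xi _] := Hx i; apply: le_trans (distA_le (x i)) _.
  by rewrite addrC lerD2l (le_trans xi)// invf_le1 ?ltr0n// ler1n.
have [y _ Hy] := compact_seq_cluster K_compact xK.
have Oy : O y.
  apply: dist_set_eq0 => //; apply/eqP; rewrite eq_le dist_set_ge0 andbT.
  apply/ler_addgt0Pl => t t0; have t2 : 0 < t / 2 by rewrite divr_gt0.
  have [i Ni /= yi] := Hy _ (Num.Def.trunc (t / 2)^-1) (near_enorm y t2).
  have [xi _] := Hx i.
  have it : i.+1%:R^-1 <= t / 2.
    rewrite -[leRHS]invrK lef_pV2 ?posrE ?invr_gt0 ?ltr0n//.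
    by apply/ltW/(lt_le_trans (truncnS_gt _)); rewrite ler_nat.
  move: (le_trans xi it) (dist_set_lip y (x i) O_nonempty); lra.
have OGy : O (G y) by exact: omega_limit_invariant.
have [i _ /= yi] := Hy _ 0%N (cG (near_enorm (G y) e0)).
have [_] := Hx i; apply/negP; rewrite -leNgt.
apply: le_trans (dist_set_le _ OGy) _.
by rewrite enormBC ltW.
Qed.

Let stable_iter (e : R) N : 0 < e ->
  exists2 c, 0 < c & forall x k, d x <= c -> (k < N)%N -> d (iter k G x) <= e.
Proof.
elim: N e => [|N IH] e e0; first by exists 1.
have [c c0 Hc] := IH e e0; have [c' c'0 Hc'] := stable_step c0.
exists (Num.min e c'); first by rewrite lt_min e0.
move=> x [|k]; rewrite le_min => /andP[xe xc'] kN//.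
by rewrite iterSr; apply: Hc => //; exact: Hc'.
Qed.

(** Attractivity from the unit neighbourhood handles all times from [N] on; continuity handles the
    finitely many earlier ones. *)
Let stable (e : R) : 0 < e ->
  exists2 c, 0 < c & forall x k, d x <= c -> d (iter k G x) <= e.
Proof.
move=> e0; have [N HN] := attract 1 e0; have [c c0 Hc] := stable_iter N e0.
exists (Num.min 1 c); first by rewrite lt_min ltr01.
move=> x k; rewrite le_min => /andP[x1 xc].
by have [kN|Nk] := ltnP k N; [exact: Hc|exact: HN].
Qed.

Lemma omega_attractor : exists O : set 'cV[R]_n,
  [/\ compact O, O !=set0, O `<=` inflate A r &
  [/\ forall S : R, exists B, forall x k,
        dist_set O x <= S -> dist_set O (iter k G x) <= B,
      forall S e : R, 0 < e -> exists N, forall x k,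
        dist_set O x <= S -> (N <= k)%N -> dist_set O (iter k G x) <= e &
      forall e : R, 0 < e -> exists2 c, 0 < c & forall x k,
        dist_set O x <= c -> dist_set O (iter k G x) <= e]].
Proof. by exists O; split => //; split. Qed.

End omega_attractor.

(** * Solutions of the averaged hybrid system *)

Lemma is_derive_linear_comp (R : realType) (V W : normedModType R) (L : V -> W)
    (f : R -> V) (t : R) (df : V) :
  scalable L -> {morph L : x y / x - y} -> continuous L ->
  is_derive t 1 f df -> is_derive t 1 (L \o f) (L df).
Proof.
move=> sL aL cL [fd fdf].
have cf : (fun h : R => h^-1 *: ((f \o shift t) (h *: 1) - f t)) @ 0^' --> df.
  by rewrite -fdf; exact: fd.
have cLf : (L \o (fun h : R => h^-1 *: ((f \o shift t) (h *: 1) - f t))) @ 0^'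
    --> L df.
  exact: cvg_comp cf (cL df).
have E : (L \o (fun h : R => h^-1 *: ((f \o shift t) (h *: 1) - f t))) =
    (fun h : R => h^-1 *: (((L \o f) \o shift t) (h *: 1) - (L \o f) t)).
  by apply/funext => h /=; rewrite sL aL.
rewrite E in cLf; apply: DeriveDef; last exact: cvg_lim cLf.
by apply/cvg_ex; exists (L df).
Qed.

(** The mean value theorem is scalar, so a flow with constant velocity is integrated through one
    coordinate functional [L] at a time. *)
Lemma linear_comp_affine (R : realType) (V : normedModType R) (L : V -> R)
    (f : R -> V) (w : V) (a b s : R) :
  scalable L -> {morph L : x y / x - y} -> continuous L ->
  {within `[a, b], continuous f} ->
  (forall t, t \in `]a, b[ -> is_derive t 1 f w) ->
  a <= s <= b -> L (f s) = L (f a) + (s - a) * L w.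
Proof.
move=> sL aL cL cf df /andP[]; rewrite le_eqVlt => /predU1P[-> _|as_ sb].
  by rewrite subrr mul0r addr0.
have cLf : {within `[a, s], continuous (L \o f)}.
  apply: within_continuous_comp; first by move=> x _; exact: cL.
  by apply: continuous_subspaceW cf; apply: subset_itvl; rewrite bnd_simp.
have dLf t : t \in `]a, s[ -> is_derive t 1 (L \o f) (L w).
  rewrite in_itv/= => /andP[ta ts]; apply: is_derive_linear_comp => //; apply: df.
  by rewrite in_itv/= ta (lt_le_trans ts).
have [c _ /= /eqP] := @MVT _ (L \o f) (fun=> L w) a s as_ dLf cLf.
by rewrite subr_eq => /eqP ->; rewrite addrC mulrC.
Qed.

Lemma coord_fst_continuous (R : realType) N i :
  continuous (fun p : 'cV[R]_N * R => p.1 i 0).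
Proof.
by move=> p; apply: (@continuous_comp _ _ _ fst (fun u : 'cV[R]_N => u i 0));
  [exact: cvg_fst|exact: coord_continuous].
Qed.

Section Hbar.
Variables (R : realType) (N : nat) (G : 'cV[R]_N -> 'cV[R]_N).
Variables (E : set (R * nat)) (xi : R -> nat -> 'cV[R]_N * R).
Hypothesis sol : hybrid_solution (@Hbar_C R N) (@Hbar_F R N) (@Hbar_D R N)
  (fun x => (G x.1, 0)) E xi.

Lemma Hbar_flow j (a b s : R) : (forall t, a <= t <= b -> E (t, j)) ->
  a <= s <= b ->
  [/\ (xi s j).1 = (xi a j).1, (xi s j).2 = (xi a j).2 + (s - a) &
      (unit_int (xi a j).2 -> unit_int (xi s j).2)].
Proof.
move=> abE asb; have [ab|ab] := ltP a b; last first.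
  have -> : s = a by apply/eqP; move: asb ab => /andP[]; lra.
  by rewrite subrr addr0.
have [_ [_ [_ [+ _]]]] := sol => /(_ j)/=.
set I := [set t | E (t, j)].
have oI t : t \in `]a, b[ -> interior I t.
  move=> tab; rewrite /interior; have := near_in_itvoo tab.
  apply: filterS => u; rewrite in_itv/= => /andP[/ltW au /ltW ub].
  by apply: abE; rewrite au.
move=> Hj; have mI : interior I !=set0.
  exists ((a + b) / 2); apply: oI; rewrite in_itv/=; apply/andP; split; lra.
have [cI dI] := Hj mI.
have cf : {within `[a, b], continuous (fun s => xi s j)}.
  apply: continuous_subspaceW cI => t /=; rewrite in_itv/= => tab.
  exact: abE.
have df t : t \in `]a, b[ -> is_derive t 1 (fun s => xi s j) (0, 1).
  by move=> /oI /dI[].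
have E2 u : a <= u <= b -> (xi u j).2 = (xi a j).2 + (u - a).
  move=> uab; rewrite -[u - a]mulr1.
  have := @linear_comp_affine _ _ (fun p : 'cV[R]_N * R => p.2)
    _ _ _ _ _ _ _ _ cf df uab.
  apply=> //.
  by move=> p; exact: cvg_snd.
split; [|exact: E2|].
  apply/matrixP => i k; rewrite (ord1 k).
  have := @linear_comp_affine _ _ (fun p : 'cV[R]_N * R => p.1 i 0)
    _ _ _ _ _ _ _ _ cf df asb.
  rewrite mxE mulr0 addr0; apply.
  - by move=> c p /=; rewrite mxE.
  - by move=> p q /=; rewrite !mxE.
  - exact: coord_fst_continuous.
rewrite !unit_intE (E2 s asb) => /andP[a0 a1].
move: (asb) => /andP[sa sb]; rewrite addr_ge0 ?subr_ge0//=.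
rewrite leNgt; apply/negP => s1.
(* The flow set constrains the state only at interior times, so an excess at [s] itself is no
   contradiction yet. The clock reaches 1 at time a + 1 - (xi a j).2; [u] is halfway from there, or
   from [a] if later, to [s]: an interior time at which the clock already exceeds 1. *)
pose u := (Num.max a (a + 1 - (xi a j).2) + s) / 2.
have ms : Num.max a (a + 1 - (xi a j).2) < s.
  by rewrite gt_max; apply/andP; split; lra.
have [ma1 ma2] : a <= Num.max a (a + 1 - (xi a j).2) /\
    a + 1 - (xi a j).2 <= Num.max a (a + 1 - (xi a j).2).
  by rewrite !le_max !lexx orbT.
have uab : u \in `]a, b[ by rewrite in_itv/= /u; apply/andP; split; lra.
have [] := dI u (oI u uab); rewrite /Hbar_C/= -/(unit_int _) unit_intE.
rewrite E2 => [/andP[_ u1] _|]; first by move: u1; rewrite /u; lra.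
by move: uab; rewrite in_itv/= => /andP[/ltW -> /ltW ->].
Qed.

Lemma Hbar_solutionE (t : R) j : E (t, j) ->
  [/\ (xi t j).1 = iter j G (xi 0 0%N).1, unit_int (xi t j).2 &
      0 <= t <= j.+1%:R].
Proof.
move=> Etj; have [[Epos Edom] [E0 [xi0 [_ jump]]]] := sol.
have [K [s [s0 [smono SE]]]] := Edom t j Etj.
have inE_ i u : (i < K)%N -> s i <= u <= s i.+1 -> E (u, i).
  move=> iK uS.
  suff : (E `&` [set p | 0 <= p.1 <= t /\ (p.2 <= j)%N]) (u, i) by case.
  by rewrite SE; split.
have [jK tj] : (j < K)%N /\ s j <= t <= s j.+1.
  have : (E `&` [set p | 0 <= p.1 <= t /\ (p.2 <= j)%N]) (t, j).
    by split => //=; rewrite lexx leqnn (Epos _ Etj).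
  by rewrite SE.
(* A solution may start anywhere in the closure of C or in D; here C is closed and contains D. *)
have xi00 : unit_int (xi 0 0%N).2.
  case: xi0 => [|->]; last by rewrite unit_intE ler01 lexx.
  have clC : closed (@Hbar_C R N).
    apply: (@closed_comp _ _ snd (@unit_int R)); last exact: itv_closed.
    by move=> x _; exact: cvg_snd.
  by move=> /clC.
(* Induction over the jump times [s i]. Each flow starts with a nonnegative clock and ends with a
   clock at most 1, so it lasts at most 1, whence [s i <= i]. *)
have start i : (i <= j)%N -> [/\ (xi (s i) i).1 = iter i G (xi 0 0%N).1,
    unit_int (xi (s i) i).2 & 0 <= s i <= i%:R].
  elim: i => [|i IH] ij; first by rewrite s0 lexx.
  have [x1 x2 /andP[si0 si]] := IH (ltnW ij).
  have iK : (i < K)%N by apply: leq_trans jK; exact: ltnW.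
  have i1K : (i.+1 < K)%N by exact: leq_trans jK.
  have sm := smono _ iK; have sm1 := smono _ i1K.
  have ssi : s i <= s i.+1 <= s i.+1 by rewrite sm lexx.
  have [f1 f2 f3] := Hbar_flow (fun u => inE_ i u iK) ssi.
  have ss1 : s i.+1 <= s i.+1 <= s i.+2 by rewrite lexx sm1.
  have [xiD ->] := jump _ _ (inE_ _ _ iK ssi) (inE_ _ _ i1K ss1).
  split => /=; first by rewrite f1 x1.
    exact: unit_int0.
  rewrite (le_trans si0)//=; move: (f3 x2) (x2).
  rewrite !unit_intE f2 -natr1; lra.
have [x1 x2 /andP[sj0 sj]] := start j (leqnn j).
have [f1 f2 f3] := Hbar_flow (fun u => inE_ j u jK) tj.
split; first by rewrite f1.
  exact: f3.
rewrite (Epos _ Etj)/=; move: (f3 x2) (x2); rewrite !unit_intE f2 -natr1; lra.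
Qed.

End Hbar.

Lemma dist_set_hyb_prod (R : realType) N (A : set 'cV[R]_N) (x : 'cV[R]_N * R) :
  A !=set0 -> unit_int x.2 ->
  dist_set_hyb (A `*` @unit_int R) x = dist_set A x.1.
Proof.
move=> A0 x2; apply/eqP; rewrite eq_le; apply/andP; split; apply: lb_le_inf.
- exact: (dist_set_has_inf x.1 A0).1.
- move=> _ [y Ay <-]; apply: ge_inf.
    by exists 0 => _ [z _ <-]; exact: sqrtr_ge0.
  (* The clock of [x] lies in [0, 1] and can be matched exactly, so it adds nothing to the
     distance. *)
  exists (y, x.2) => //=.
  by rewrite subrr expr0n/= addr0 sqrtr_sqr ger0_norm// enorm_ge0.
- have [y Ay] := A0.
  by exists (Num.sqrt (enorm (x.1 - y) ^+ 2 + (x.2 - x.2) ^+ 2)), (y, x.2).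
- move=> _ [[y z] [/= Ay _] <-]; apply: le_trans (dist_set_le _ Ay) _.
  rewrite -[leLHS]ger0_norm ?enorm_ge0// -sqrtr_sqr; apply: ler_wsqrtr.
  by rewrite lerDl sqr_ge0.
Qed.

Lemma Hbar_UGAS (R : realType) N (G : 'cV[R]_N -> 'cV[R]_N) (O : set 'cV[R]_N) :
  O !=set0 ->
  (forall S : R, exists B, forall x k,
     dist_set O x <= S -> dist_set O (iter k G x) <= B) ->
  (forall S e : R, 0 < e -> exists K, forall x k,
     dist_set O x <= S -> (K <= k)%N -> dist_set O (iter k G x) <= e) ->
  (forall e : R, 0 < e -> exists2 c, 0 < c & forall x k,
     dist_set O x <= c -> dist_set O (iter k G x) <= e) ->
  UGAS_hyb (@Hbar_C R N) (@Hbar_F R N) (@Hbar_D R N)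
    (fun x => (G x.1, 0)) (O `*` @unit_int R).
Proof.
move=> O0 bnd attr stab.
(* Each flow interval has length at most one, so [t + j <= 2 j + 1]. *)
have [||S|S e e0|e e0|beta KLb Hb] := @KL_bound R ('cV[R]_N * nat)%type
  (fun p => dist_set O p.1) (fun p => dist_set O (iter p.2 G p.1))
  (fun p => p.2.*2.+1%:R) _ _ _ _ _.
- by move=> p; exact: dist_set_ge0.
- by move=> p; exact: dist_set_ge0.
- by have [B HB] := bnd S; exists B => p; exact: HB.
- have [K HK] := attr S e e0; exists K.*2.+1%:R => p pS.
  by rewrite ler_nat => Kp; apply: HK => //; lia.
- by have [c c0 Hc] := stab e e0; exists c => // p; exact: Hc.
exists beta => // E xi sol t j Etj.
have [x1 x2 /andP[t0 tj]] := Hbar_solutionE sol Etj.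
have [_ xi0 _] := Hbar_solutionE sol sol.2.1.
rewrite !dist_set_hyb_prod// x1.
apply: le_trans (Hb ((xi 0 0%N).1, j) (ler0n _ _)) _ => /=.
apply: (KLb.2 _ (dist_set_ge0 _ _)).1; first by rewrite addr_ge0.
by rewrite -addnn -addSn natrD lerD2r.
Qed.

Theorem theorem3 (R : realType) (n m : nat)
  (phi : 'cV[R]_n -> R) (gradphi : 'cV[R]_n -> 'cV[R]_n) (Lphi : R)
  (g : 'cV[R]_(n + m) -> 'cV[R]_n -> 'cV[R]_(n + m))
  (h : 'cV[R]_(n + m) -> 'cV[R]_n)
  (v : R -> 'cV[R]_n)
  (Ad : set 'cV[R]_(n + m)) (alpha : R -> R) :
  is_gradient phi gradphi ->
  continuous gradphi ->
  (forall u1 u2, enorm (gradphi u1 - gradphi u2) <= Lphi * enorm (u1 - u2)) ->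
  continuous (fun p : 'cV[R]_(n + m) * 'cV[R]_n => g p.1 p.2) ->
  continuous h ->
  UPE v ->
  compact Ad -> Ad !=set0 ->
  class_Kinf alpha ->
  ISS_with_gain (fun eta e => g eta (gradphi (h eta) + e)) Ad alpha ->
  forall a : R, 0 < a ->
  exists Abar : set 'cV[R]_(n + m),
    [/\ compact Abar, Abar !=set0,
        Abar `<=` inflate Ad (alpha (M_v v ^+ 3 * Lphi * a)) &
        UGAS_hyb (@Hbar_C R (n + m)) (@Hbar_F R (n + m)) (@Hbar_D R (n + m))
          (Hbar_G g h phi v a) (Abar `*` @unit_int R)].
Proof.
move=> grad_phi _ lip cg ch uv cA A0 [[alpha0 [_ alpha_mono]] _].
move=> [beta KLb iss] a a0.
pose G x := g x (Phibar phi v a (h x)).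
pose err x := Phibar phi v a (h x) - gradphi (h x).
set c := M_v v ^+ 3 * Lphi * a.
have err_c x : enorm (err x) <= c by exact: Phibar_error.
(* The sign of c is read off the error bound, as no sign of [Lphi] is assumed; [alpha] is monotone
   only on nonnegative arguments. *)
have c0 : 0 <= c := le_trans (enorm_ge0 _) (err_c 0).
have alpha_le s : 0 <= s -> s <= c -> alpha s <= alpha c.
  move=> s0; rewrite le_eqVlt => /predU1P[->//|sc].
  exact/ltW/alpha_mono.
have ac0 : 0 <= alpha c by rewrite -alpha0 alpha_le.
have cG : continuous G.
  move=> x; apply: (@continuous_comp _ _ _ (fun x => (x, Phibar phi v a (h x)))
    (fun p => g p.1 p.2)); last exact: cg.
  have cP : {for x, continuous (fun x => Phibar phi v a (h x))}.
    apply: (@continuous_comp _ _ _ h); first exact: ch.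
    exact: (Phibar_continuous grad_phi lip uv a0).
  exact: (cvg_pair cvg_id cP).
have practical x k :
    dist_set Ad (iter k G x) <= beta (dist_set Ad x) k%:R + alpha c.
  (* The orbit of [G] solves the ISS system when the input is the averaging error evaluated along
     that same orbit. *)
  pose e j := err (iter j G x).
  apply: le_trans (iss e (fun j => iter j G x) _ _ k) _.
  - by exists c => j; exact: err_c.
  - by move=> j; rewrite iterS /G /e /err addrC subrK.
  rewrite lerD2l alpha_le//.
    apply: le_trans (enorm_ge0 (e 0%N)) _; apply: ub_le_sup; last by exists 0%N.
    by exists c => _ [j _ <-]; exact: err_c.
  by apply: ge_sup => [|_ [j _ <-]]; [exists (enorm (e 0%N)), 0%N|exact: err_c].
have [Abar [cAbar Abar0 AbarA [bnd attr stab]]] :=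
  omega_attractor cG cA A0 ac0 KLb practical.
by exists Abar; split => //; exact: (Hbar_UGAS Abar0 bnd attr stab).
Qed.
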